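(* Let $n\geq 3$ and $1\leq i<j\leq n$ be integers, and let $t_{1},\ldots,t_{n}$ be independent indeterminates (rational parameters). Then the system of equations \[ \sigma_{i}(x_{1},\ldots,x_{n})=\sigma_{i}(t_{1},\ldots,t_{n}),\qquad \sigma_{j}(x_{1},\ldots,x_{n})=\sigma_{j}(t_{1},\ldots,t_{n}) \] has infinitely many solutions $(x_1,\ldots,x_n)$ with $x_{1},\ldots,x_n\in\mathbb{Q}(t_{1},\ldots,t_{n})$.
   Context: For $1\leq i\leq n$, $\sigma_{i}(x_{1},\ldots,x_{n})=\sum_{1\leq k_{1}<\cdots<k_{i}\leq n}x_{k_{1}}\cdots x_{k_{i}}$ denotes the $i$-th elementary symmetric polynomial. *)

(* Defs.v *)
From mathcomp Require Import all_boot all_order all_algebra.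
From mathcomp Require Import classical_sets cardinality.
From mathcomp Require Import mpoly.

Set Implicit Arguments.
Unset Strict Implicit.
Unset Printing Implicit Defensive.

Import GRing.Theory.
Local Open Scope ring_scope.

(* The field Q(t_0, ..., t_{n-1}) of rational functions in n independent
   indeterminates. *)
Definition ratfun (n : nat) : fieldType := {fraction {mpoly rat[n]}}.

Definition indet (n : nat) : {ffun 'I_n -> ratfun n} :=
  [ffun k : 'I_n => tofrac ('X_k : {mpoly rat[n]})].

(* Indexed by all i : nat: equal to 1 for i = 0 and to 0 for i > n. *)
Definition esigma (n : nat) (K : fieldType) (i : nat) (x : {ffun 'I_n -> K}) : K :=
  (mesym n K i).@[x].

Lemma esigmaE (n : nat) (K : fieldType) (i : nat) (x : {ffun 'I_n -> K}) :
  esigma i x = \sum_(h : {set 'I_n} | #|h| == i) \prod_(k in h) x k.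
Proof.
rewrite /esigma /mesym rmorph_sum /=; apply: eq_bigr => h _.
by rewrite rmorph_prod; apply: eq_bigr => k _; rewrite /= mevalXU.
Qed.

(* Main.v *)
(* Keep n - 3 of the variables equal to the corresponding t_k, put
   P = prod (X - t_k) over these k, and choose B <> 0 of degree at most 2 such
   that the coefficients of B P in degrees n - i and n - j vanish.  By Vieta, a
   triple (x1, x2, x3) completes to a solution as soon as
   (X - x1)(X - x2)(X - x3) = (X - t1)(X - t2)(X - t3) + l B for some scalar l;
   these triples generically form a curve of genus one.

   Such a triple (t1, t2, t3) yields another one.  Let m be the Moebius map
   t1 -> t2 -> t3 -> t1.  The points (x, y) of the curve with y = m x are the
   three cyclic shifts of (t1, t2) and a fourth one, which is rational.  With
   w1 = B(t1) (t2 - t3)^3, w2 = B(t2) (t3 - t1)^3, w3 = B(t3) (t1 - t2)^3, this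
   step acts by (w1 : w2 : w3) -> (G^3 : H^3 : w1 w2 w3 D^3) for forms D, G, H
   of degrees 2, 3, 3: it is multiplication by -3 on the curve.

   To see that the orbit of the generic triple is infinite, specialise the t_k
   to rational numbers for which, up to scaling, the differences of t1, t2, t3
   and the values of B there are integers, t1 = t2 <> t3 and
   B(t1) = B(t2) <> 0 modulo 3.  This is preserved, and since 3 divides D, each step increases the
   3-adic valuation of (t1 - t2) / (t2 - t3). *)
Require Import Defs.
From mathcomp Require Import all_boot all_order all_algebra.
From mathcomp Require Import classical_sets cardinality.
From mathcomp Require Import mpoly.
From mathcomp Require boolp.
From mathcomp Require Import ring lra zify.
Set Implicit Arguments.
Unset Strict Implicit.
Unset Printing Implicit Defensive.

Import Order.TTheory GRing.Theory Num.Theory.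
Local Open Scope ring_scope.
Local Open Scope classical_set_scope.

(** * The step on triples *)

Definition dot3 (R : comPzRingType) (p1 p2 p3 w1 w2 w3 : R) : R :=
  p1 * w1 + p2 * w2 + p3 * w3.

(** The form D of the step: half the sum of the squared differences, and the norm form of w1 + w2 z
    + w3 z^2 for a primitive cube root of unity z. *)
Definition formD (R : comPzRingType) (w1 w2 w3 : R) : R :=
  w1 ^+ 2 + w2 ^+ 2 + w3 ^+ 2 - w1 * w2 - w2 * w3 - w3 * w1.

(** The form G of the step; H is [formG w2 w1 w3]. *)
Definition formG (R : comPzRingType) (w1 w2 w3 : R) : R :=
  w1 * w2 ^+ 2 + w2 * w3 ^+ 2 + w3 * w1 ^+ 2 - 3 * (w1 * w2 * w3).

Definition formV (R : comPzRingType) (w1 w2 w3 : R) : R :=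
  (w1 - w2) * (w2 - w3) * (w3 - w1).

Section Triple.
Variable F : fieldType.
Implicit Types t b w q : F.

(* The new triple is the preimage, under the Moebius map sending t1, t2, t3 to
   0, 1, oo, of x = (w2 - w1) / (w3 - w1), y = 1 / (1 - x) and
   z = - w1 / (w3 x y), with denominators cleared. *)
Definition den1 t1 t2 t3 w1 w2 w3 :=
  dot3 (t3 - t1) (t1 - t2) (t2 - t3) w1 w2 w3.

Definition den2 t1 t2 t3 w1 w2 w3 :=
  dot3 (t1 - t2) (t2 - t3) (t3 - t1) w1 w2 w3.

Definition den3 t1 t2 t3 w1 w2 w3 :=
  dot3 (t2 - t3) (t3 - t1) (t1 - t2) (w2 * w3) (w1 * w3) (w1 * w2).

Definition new1 t1 t2 t3 w1 w2 w3 :=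
  dot3 ((t3 - t1) * t2) ((t1 - t2) * t3) ((t2 - t3) * t1) w1 w2 w3 /
  den1 t1 t2 t3 w1 w2 w3.

Definition new2 t1 t2 t3 w1 w2 w3 :=
  dot3 ((t1 - t2) * t3) ((t2 - t3) * t1) ((t3 - t1) * t2) w1 w2 w3 /
  den2 t1 t2 t3 w1 w2 w3.

Definition new3 t1 t2 t3 w1 w2 w3 :=
  dot3 ((t2 - t3) * t1) ((t3 - t1) * t2) ((t1 - t2) * t3)
    (w2 * w3) (w1 * w3) (w1 * w2) /
  den3 t1 t2 t3 w1 w2 w3.

Definition quad q0 q1 q2 x := q0 + q1 * x + q2 * x ^+ 2.

Definition quadp q0 q1 q2 : {poly F} := q0%:P + q1%:P * 'X + q2%:P * 'X^2.

Definition cubic t1 t2 t3 : {poly F} :=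
  ('X - t1%:P) * ('X - t2%:P) * ('X - t3%:P).

Lemma quad_eq0 q0 q1 q2 t1 t2 t3 :
  t1 != t2 -> t2 != t3 -> t3 != t1 ->
  quad q0 q1 q2 t1 = 0 -> quad q0 q1 q2 t2 = 0 -> quad q0 q1 q2 t3 = 0 ->
  [/\ q0 = 0, q1 = 0 & q2 = 0].
Proof.
rewrite -(subr_eq0 t1) -(subr_eq0 t2) -(subr_eq0 t3) => n12 n23 n31 e1 e2 e3.
(* Divided differences over (t1, t2) and over (t2, t3); their difference then isolates [q2]. *)
have z12 : q1 + q2 * (t1 + t2) = 0.
  apply: (mulfI n12); rewrite mulr0 -[RHS](subrr 0) -{1}e1 -e2 /quad; ring.
have z23 : q1 + q2 * (t2 + t3) = 0.
  apply: (mulfI n23); rewrite mulr0 -[RHS](subrr 0) -{1}e2 -e3 /quad; ring.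
have q2_0 : q2 = 0.
  by apply: (mulfI n31); rewrite mulr0 -[RHS](subrr 0) -{1}z23 -z12; ring.
have q1_0 : q1 = 0 by rewrite -z12 q2_0 mul0r addr0.
by split=> //; rewrite -e1 /quad q1_0 q2_0 !mul0r !addr0.
Qed.

Section Moebius.
Variables t1 t2 t3 w1 w2 w3 : F.
Let d1 := den1 t1 t2 t3 w1 w2 w3.
Let d2 := den2 t1 t2 t3 w1 w2 w3.
Let d3 := den3 t1 t2 t3 w1 w2 w3.
Let x1 := new1 t1 t2 t3 w1 w2 w3.
Let x2 := new2 t1 t2 t3 w1 w2 w3.
Let x3 := new3 t1 t2 t3 w1 w2 w3.
Let k := (t2 - t3) * (t3 - t1) * (t1 - t2).
Hypotheses (d1n : d1 != 0) (d2n : d2 != 0) (d3n : d3 != 0).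

(** Here and in the next two lemmas the forms D, G, H appear as factors of the differences of the
    new triple; their cubes enter the new w. *)
Lemma new_sub12 : x1 - x2 = k * formD w1 w2 w3 / (d1 * d2).
Proof.
move: d1n d2n; rewrite /x1 /x2 /new1 /new2 /d1 /d2 /k /formD /den1 /den2 /dot3.
by move=> ? ?; field; exact/andP.
Qed.

Lemma new_sub23 : x2 - x3 = - (k * formG w1 w2 w3) / (d2 * d3).
Proof.
move: d2n d3n; rewrite /x2 /x3 /new2 /new3 /d2 /d3 /k /formG /den2 /den3 /dot3.
by move=> ? ?; field; exact/andP.
Qed.

Lemma new_sub31 : x3 - x1 = - (k * formG w2 w1 w3) / (d3 * d1).
Proof.
move: d3n d1n; rewrite /x3 /x1 /new3 /new1 /d3 /d1 /k /formG /den3 /den1 /dot3.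
by move=> ? ?; field; exact/andP.
Qed.

Lemma sub_new1 :
  [/\ t1 - x1 = (t3 - t1) * (t1 - t2) * (w1 - w2) / d1,
      t2 - x1 = (t1 - t2) * (t2 - t3) * (w2 - w3) / d1 &
      t3 - x1 = (t2 - t3) * (t3 - t1) * (w3 - w1) / d1].
Proof.
by move: d1n; rewrite /x1 /new1 /d1 /den1 /dot3 => ?; split; field.
Qed.

Lemma sub_new2 :
  [/\ t1 - x2 = (t3 - t1) * (t1 - t2) * (w3 - w1) / d2,
      t2 - x2 = (t1 - t2) * (t2 - t3) * (w1 - w2) / d2 &
      t3 - x2 = (t2 - t3) * (t3 - t1) * (w2 - w3) / d2].
Proof.
by move: d2n; rewrite /x2 /new2 /d2 /den2 /dot3 => ?; split; field.
Qed.

Lemma sub_new3 :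
  [/\ t1 - x3 = (t3 - t1) * (t1 - t2) * (w1 * (w3 - w2)) / d3,
      t2 - x3 = (t1 - t2) * (t2 - t3) * (w2 * (w1 - w3)) / d3 &
      t3 - x3 = (t2 - t3) * (t3 - t1) * (w3 * (w2 - w1)) / d3].
Proof.
by move: d3n; rewrite /x3 /new3 /d3 /den3 /dot3 => ?; split; field.
Qed.
End Moebius.

Section Step.
Variables q0 q1 q2 t1 t2 t3 : F.
Let b1 := quad q0 q1 q2 t1.
Let b2 := quad q0 q1 q2 t2.
Let b3 := quad q0 q1 q2 t3.
Let w1 := b1 * (t2 - t3) ^+ 3.
Let w2 := b2 * (t3 - t1) ^+ 3.
Let w3 := b3 * (t1 - t2) ^+ 3.
Let d1 := den1 t1 t2 t3 w1 w2 w3.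
Let d2 := den2 t1 t2 t3 w1 w2 w3.
Let d3 := den3 t1 t2 t3 w1 w2 w3.
Let x1 := new1 t1 t2 t3 w1 w2 w3.
Let x2 := new2 t1 t2 t3 w1 w2 w3.
Let x3 := new3 t1 t2 t3 w1 w2 w3.
Let k := (t2 - t3) * (t3 - t1) * (t1 - t2).
Hypotheses (d1n : d1 != 0) (d2n : d2 != 0) (d3n : d3 != 0).
Hypotheses (t12 : t1 != t2) (t23 : t2 != t3) (t31 : t3 != t1).
Hypothesis Vn : formV w1 w2 w3 != 0.

Let lam := - (k ^+ 3 * formV w1 w2 w3) / (d1 * d2 * d3).

(** Multiply [sub_new1], [sub_new2] and [sub_new3]. The differences of the w give the same [formV]
    up to sign in all three products, and the cube inside the remaining factor w1, w2 or w3
    completes the differences of the t to [k ^+ 3]. *)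
Lemma new_values :
  [/\ (t1 - x1) * (t1 - x2) * (t1 - x3) = lam * b1,
      (t2 - x1) * (t2 - x2) * (t2 - x3) = lam * b2 &
      (t3 - x1) * (t3 - x2) * (t3 - x3) = lam * b3].
Proof.
rewrite /x1 /x2 /x3; have [-> -> ->] := sub_new1 d1n.
have [-> -> ->] := sub_new2 d2n; have [-> -> ->] := sub_new3 d3n.
rewrite -/d1 -/d2 -/d3 /lam.
move: (d1) (d2) (d3) d1n d2n d3n => c1 c2 c3 n1 n2 n3.
rewrite /k /formV /w1 /w2 /w3; move: (b1) (b2) (b3) => v1 v2 v3.
by split; field; rewrite n1 n2 n3.
Qed.

(** Both cubics are monic, so their difference minus [lam] B has degree at most 2; by [new_values]
    it vanishes at the three distinct points t1, t2, t3. *)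
Lemma cubic_new : cubic x1 x2 x3 = cubic t1 t2 t3 + lam%:P * quadp q0 q1 q2.
Proof.
have [e1 e2 e3] := new_values.
(* The coefficients of [cubic x1 x2 x3 - cubic t1 t2 t3]. *)
pose r2 := t1 + t2 + t3 - (x1 + x2 + x3).
pose r1 := x1 * x2 + x2 * x3 + x3 * x1 - (t1 * t2 + t2 * t3 + t3 * t1).
pose r0 := t1 * t2 * t3 - x1 * x2 * x3.
have expand t : quad (r0 - lam * q0) (r1 - lam * q1) (r2 - lam * q2) t =
  (t - x1) * (t - x2) * (t - x3) - (t - t1) * (t - t2) * (t - t3) -
  lam * quad q0 q1 q2 t.
  by rewrite /quad /r0 /r1 /r2; move: (lam) (x1) (x2) (x3) => *; ring.
have vanish t b : quad q0 q1 q2 t = b ->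
    (t - x1) * (t - x2) * (t - x3) = lam * b ->
    (t - t1) * (t - t2) * (t - t3) = 0 ->
    quad (r0 - lam * q0) (r1 - lam * q1) (r2 - lam * q2) t = 0.
  by move=> <- e z; rewrite expand e z subr0 subrr.
have [z0 z1 z2] :
    [/\ r0 - lam * q0 = 0, r1 - lam * q1 = 0 & r2 - lam * q2 = 0].
  by apply: (quad_eq0 t12 t23 t31);
    [apply: vanish e1 _ | apply: vanish e2 _ | apply: vanish e3 _];
    rewrite ?subrr ?(mul0r, mulr0).
apply/eqP; rewrite -subr_eq0 opprD addrA; apply/eqP.
transitivity (quadp (r0 - lam * q0) (r1 - lam * q1) (r2 - lam * q2)).
  rewrite /quadp /cubic /r0 /r1 /r2; move: (lam) (x1) (x2) (x3) => *.
  rewrite !(polyCB, polyCD, polyCM); ring.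
by rewrite z0 z1 z2 /quadp !(mul0r, addr0).
Qed.

(** At a root x of the new cubic, [cubic_new] gives lam B(x) = (t1 - x)(t2 - x)(t3 - x), whose
    factors are known from [sub_new1], [sub_new2] and [sub_new3]. Division by [lam] is allowed
    because [formV] does not vanish. *)
Lemma quad_new :
  [/\ quad q0 q1 q2 x1 = - (d1 * d2 * d3) / (k * d1 ^+ 3),
      quad q0 q1 q2 x2 = - (d1 * d2 * d3) / (k * d2 ^+ 3) &
      quad q0 q1 q2 x3 = w1 * w2 * w3 * (d1 * d2 * d3) / (k * d3 ^+ 3)].
Proof.
have kn : k != 0 by rewrite !mulf_neq0 ?subr_eq0.
have lamn : lam != 0.
  rewrite /lam mulf_neq0 ?oppr_eq0 ?invr_eq0 //; last by do 2?apply: mulf_neq0.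
  by apply: mulf_neq0 => //; apply: expf_neq0.
have ev x : (x - x1) * (x - x2) * (x - x3) =
    lam * quad q0 q1 q2 x - (t1 - x) * (t2 - x) * (t3 - x).
  have := congr1 (horner^~ x) cubic_new.
  rewrite /cubic /quadp /quad !(hornerE, hornerXn) => ->.
  by move: (lam) => *; ring.
have evl x : (x - x1) * (x - x2) * (x - x3) = 0 ->
    quad q0 q1 q2 x = (t1 - x) * (t2 - x) * (t3 - x) / lam.
  by rewrite ev => /subr0_eq <-; rewrite mulrAC mulfV ?mul1r.
have tn : [/\ t2 - t3 != 0, t3 - t1 != 0 & t1 - t2 != 0] by rewrite !subr_eq0.
have Vn' : [/\ w1 - w2 != 0, w2 - w3 != 0 & w3 - w1 != 0].
  by move: Vn; rewrite /formV !mulf_eq0 !negb_or => /andP[/andP[]].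
split; rewrite evl ?subrr ?(mul0r, mulr0) //.
- rewrite /x1; have [-> -> ->] := sub_new1 d1n.
  rewrite -?/d1 -?/d2 -?/d3 /lam /k /formV.
  move: (d1) (d2) (d3) (w1) (w2) (w3) tn Vn' d1n d2n d3n => c1 c2 c3 u1 u2 u3.
  by move=> [? ? ?] [? ? ?] ? ? ?; field;
    do !(apply/andP; split=> //); rewrite oppr_eq0 !(mulf_neq0, expf_neq0).
- rewrite /x2; have [-> -> ->] := sub_new2 d2n.
  rewrite -?/d1 -?/d2 -?/d3 /lam /k /formV.
  move: (d1) (d2) (d3) (w1) (w2) (w3) tn Vn' d1n d2n d3n => c1 c2 c3 u1 u2 u3.
  by move=> [? ? ?] [? ? ?] ? ? ?; field;
    do !(apply/andP; split=> //); rewrite oppr_eq0 !(mulf_neq0, expf_neq0).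
rewrite /x3; have [-> -> ->] := sub_new3 d3n.
rewrite -?/d1 -?/d2 -?/d3 /lam /k /formV.
move: (d1) (d2) (d3) (w1) (w2) (w3) tn Vn' d1n d2n d3n => c1 c2 c3 u1 u2 u3.
by move=> [? ? ?] [? ? ?] ? ? ?; field;
  do !(apply/andP; split=> //); rewrite oppr_eq0 !(mulf_neq0, expf_neq0).
Qed.
End Step.
End Triple.

(** * The 3-adic invariant *)

Definition mod3 (m : int) : 'F_3 := m%:~R.

Lemma mod3_neq0 m : mod3 m != 0 -> m != 0.
Proof. by apply: contraNneq => ->. Qed.

Lemma dvd3_mod3 (m : int) : (3 %| m)%Z = (mod3 m == 0).
Proof. exact: (dvdz_pcharf (@pchar_Fp 3 isT)). Qed.

(** Twice the form is a sum of squares. This keeps the first two points distinct after a step,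
    although D vanishes modulo 3. *)
Lemma formD_gt0 (R : realDomainType) (w1 w2 w3 : R) :
  w1 != w2 -> 0 < formD w1 w2 w3.
Proof.
rewrite -subr_eq0 => n12.
have p : 0 < (w1 - w2) ^+ 2 by rewrite exprn_even_gt0.
have := sqr_ge0 (w2 - w3); have := sqr_ge0 (w3 - w1).
rewrite /formD; move: p; nra.
Qed.

(** Here al, be, ga stand for the rescaled t2 - t3, t3 - t1, t1 - t2, and d3 is [den3] with a factor
    ga removed. Modulo 3 one has ga = w3 = 0, be = - al and w2 = - w1, so every form collapses to a
    monomial in al and w1; D becomes 3 w1^2 = 0, which supplies the additional factor 3. *)
Lemma next_mod3 (al be ga b1 b2 b3 : int) (n : nat) :
    al + be + ga = 0 -> mod3 al != 0 -> mod3 b1 != 0 -> mod3 b2 = mod3 b1 ->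
    ga != 0 -> b3 != 0 -> (3 ^+ n.+1 %| ga)%Z ->
  let w1 := b1 * al ^+ 3 in
  let w2 := b2 * be ^+ 3 in
  let w3 := b3 * ga ^+ 3 in
  let d1 := dot3 be ga al w1 w2 w3 in
  let d2 := dot3 ga al be w1 w2 w3 in
  let d3 := dot3 (w1 * w2) (al * w2 * (b3 * ga ^+ 2))
                 (be * w1 * (b3 * ga ^+ 2)) 1 1 1 in
  [/\ mod3 (formG w1 w2 w3) != 0 /\ mod3 (formG w2 w1 w3) != 0,
      mod3 d1 != 0, mod3 d3 != 0, mod3 d1 = mod3 d2 &
      mod3 (formV w1 w2 w3) != 0] /\
  [/\ mod3 w1 != 0, mod3 w2 != 0, w3 != 0,
      formD w1 w2 w3 * (ga * d3) != 0 &
      (3 ^+ n.+2 %| formD w1 w2 w3 * (ga * d3))%Z].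
Proof.
move=> sum0 aln b1n eb gan b3n dga w1 w2 w3 d1 d2 d3.
have ga0 : mod3 ga = 0.
  apply/eqP; rewrite -dvd3_mod3; apply: dvdz_trans dga.
  by rewrite exprS dvdz_mulr.
have be_al : mod3 be = - mod3 al.
  have : mod3 (al + be + ga) = 0 by rewrite sum0.
  rewrite /mod3 !rmorphD /= -!/(mod3 _) ga0 addr0 addrC.
  by move/eqP; rewrite addr_eq0 => /eqP.
have ew1 : mod3 w1 = mod3 b1 * mod3 al ^+ 3 by rewrite /mod3 rmorphM rmorphXn.
have ew2 : mod3 w2 = - mod3 w1.
  have -> : mod3 w2 = mod3 b2 * mod3 be ^+ 3 by rewrite /mod3 rmorphM rmorphXn.
  by rewrite ew1 eb be_al; ring.
have ew3 : mod3 w3 = 0.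
  have -> : mod3 w3 = mod3 b3 * mod3 ga ^+ 3 by rewrite /mod3 rmorphM rmorphXn.
  by rewrite ga0 expr0n mulr0.
have w1n : mod3 w1 != 0 by rewrite ew1 mulf_neq0 ?expf_neq0.
have w2n : mod3 w2 != 0 by rewrite ew2 oppr_eq0.
have w3n : w3 != 0 by rewrite mulf_neq0 ?expf_neq0.
have eG : mod3 (formG w1 w2 w3) = mod3 w1 ^+ 3.
  transitivity (formG (mod3 w1) (mod3 w2) (mod3 w3)).
    by rewrite /formG /mod3; ring.
  by rewrite ew2 ew3 /formG; ring.
have eH : mod3 (formG w2 w1 w3) = mod3 w2 ^+ 3.
  transitivity (formG (mod3 w2) (mod3 w1) (mod3 w3)).
    by rewrite /formG /mod3; ring.
  by rewrite ew2 ew3 /formG; ring.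
have ed1 : mod3 d1 = - (mod3 al * mod3 w1).
  transitivity
    (dot3 (mod3 be) (mod3 ga) (mod3 al) (mod3 w1) (mod3 w2) (mod3 w3)).
    by rewrite /d1 /dot3 /mod3; ring.
  by rewrite ew2 ew3 be_al ga0 /dot3; ring.
have ed2 : mod3 d2 = - (mod3 al * mod3 w1).
  transitivity
    (dot3 (mod3 ga) (mod3 al) (mod3 be) (mod3 w1) (mod3 w2) (mod3 w3)).
    by rewrite /d2 /dot3 /mod3; ring.
  by rewrite ew2 ew3 be_al ga0 /dot3; ring.
have ed3 : mod3 d3 = - (mod3 w1 ^+ 2).
  transitivity (dot3 (mod3 w1 * mod3 w2)
      (mod3 al * mod3 w2 * (mod3 b3 * mod3 ga ^+ 2))
      (mod3 be * mod3 w1 * (mod3 b3 * mod3 ga ^+ 2)) 1 1 1).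
    by rewrite /d3 /dot3 /mod3; ring.
  by rewrite ew2 ga0 /dot3; ring.
have eD : mod3 (formD w1 w2 w3) = 0.
  transitivity (formD (mod3 w1) (mod3 w2) (mod3 w3)).
    by rewrite /formD /mod3; ring.
  rewrite ew2 ew3 /formD.
  transitivity (3%:R * mod3 w1 ^+ 2); first by ring.
  by rewrite (_ : 3%:R = 0) ?mul0r //; apply/val_inj.
have eV : mod3 (formV w1 w2 w3) = - (mod3 w1 ^+ 3).
  transitivity (formV (mod3 w1) (mod3 w2) (mod3 w3)).
    by rewrite /formV /mod3; ring.
  rewrite ew2 ew3 /formV.
  transitivity (3%:R * mod3 w1 ^+ 3 - mod3 w1 ^+ 3); first by ring.
  by rewrite (_ : 3%:R = 0) ?mul0r ?sub0r //; apply/val_inj.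
have d3n : mod3 d3 != 0 by rewrite ed3 oppr_eq0 expf_neq0.
split; split=> //.
- by rewrite eG eH !expf_neq0.
- by rewrite ed1 oppr_eq0 mulf_neq0.
- by rewrite ed1 ed2.
- by rewrite eV oppr_eq0 expf_neq0.
(* D is zero modulo 3, so its nonvanishing is shown over the integers: w1 = w2 would make [formV]
   zero. *)
- apply: mulf_neq0; last exact: mulf_neq0 gan (mod3_neq0 d3n).
  rewrite gt_eqF // formD_gt0 //.
  apply: contraNneq w1n => e12.
  have : mod3 w1 ^+ 3 == 0; last by rewrite expf_eq0.
  by rewrite -oppr_eq0 -eV /formV e12 subrr !mul0r.
- rewrite exprS dvdz_mul ?dvdz_mulr //.
  by rewrite dvd3_mod3 eD.
Qed.

(** The differences and the values of B are scaled independently, by [rho] and [mu]. Since al is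
    prime to 3, the index n says that (t1 - t2) / (t2 - t3) = ga / al has 3-adic valuation at least
    n + 1. The integers ga and b3 may vanish modulo 3, hence the separate conditions that they are
    nonzero. *)
Definition adapted (q0 q1 q2 : rat) (n : nat) (t1 t2 t3 : rat) : Prop :=
  exists (rho mu : rat) (al be ga b1 b2 b3 : int),
  [/\ rho != 0, t2 - t3 = rho * al%:~R, t3 - t1 = rho * be%:~R &
      t1 - t2 = rho * ga%:~R] /\
  [/\ mu != 0, quad q0 q1 q2 t1 = mu * b1%:~R, quad q0 q1 q2 t2 = mu * b2%:~R &
      quad q0 q1 q2 t3 = mu * b3%:~R] /\
  [/\ mod3 al != 0, ga != 0 & (3 ^+ n.+1 %| ga)%Z] /\
  [/\ mod3 b1 != 0, mod3 b2 = mod3 b1 & b3 != 0].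

Ltac nonzero :=
  by do ?[done | rewrite oppr_eq0 | rewrite invr_eq0 |
          apply: mulf_neq0 | apply: expf_neq0].

Section Step.
Variables (q0 q1 q2 : rat) (n : nat) (t1 t2 t3 : rat).
Let w1 := quad q0 q1 q2 t1 * (t2 - t3) ^+ 3.
Let w2 := quad q0 q1 q2 t2 * (t3 - t1) ^+ 3.
Let w3 := quad q0 q1 q2 t3 * (t1 - t2) ^+ 3.
Let d1 := den1 t1 t2 t3 w1 w2 w3.
Let d2 := den2 t1 t2 t3 w1 w2 w3.
Let d3 := den3 t1 t2 t3 w1 w2 w3.

Lemma adapted_new :
  adapted q0 q1 q2 n t1 t2 t3 ->
  [/\ d1 != 0, d2 != 0, d3 != 0 & formV w1 w2 w3 != 0] /\
  [/\ t1 != t2, t2 != t3, t3 != t1 &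
  adapted q0 q1 q2 n.+1 (new1 t1 t2 t3 w1 w2 w3) (new2 t1 t2 t3 w1 w2 w3)
    (new3 t1 t2 t3 w1 w2 w3)].
Proof.
move=> [rho [mu [al [be [ga [b1 [b2 [b3 [ht [hb hm]]]]]]]]]].
move: ht hb hm => [rn e23 e31 e12] [mn eb1 eb2 eb3].
move=> [[aln gan dga] [b1n eb b3n]].
have sum0 : al + be + ga = 0.
  apply/eqP; rewrite -(intr_eq0 rat) -(mulrI_eq0 _ (mulfI rn)); apply/eqP.
  by rewrite !rmorphD /= !mulrDr -e23 -e31 -e12; ring.
have [] := next_mod3 sum0 aln b1n eb gan b3n dga.
set W1 := b1 * _; set W2 := b2 * _; set W3 := b3 * _ ^+ 3.
set D1 := dot3 be _ _ _ _ _; set D2 := dot3 ga _ _ _ _ _.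
set D3 := dot3 (W1 * W2) _ _ _ _ _ => -[[Gn Hn] D1n D3n eD12 Vn].
move=> [W1n W2n W3n Dn dD].
have ben : mod3 be != 0.
  move: W2n; rewrite /W2 /mod3 rmorphM rmorphXn mulf_eq0 negb_or expf_eq0.
  by case/andP.
have D2n : mod3 D2 != 0 by rewrite -eD12.
have ew1 : w1 = mu * rho ^+ 3 * W1%:~R by rewrite /w1 e23 eb1 /W1; ring.
have ew2 : w2 = mu * rho ^+ 3 * W2%:~R by rewrite /w2 e31 eb2 /W2; ring.
have ew3 : w3 = mu * rho ^+ 3 * W3%:~R by rewrite /w3 e12 eb3 /W3; ring.
have ed1 : d1 = mu * rho ^+ 4 * D1%:~R.
  by rewrite /d1 /den1 e23 e31 e12 ew1 ew2 ew3 /D1 /dot3; ring.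
have ed2 : d2 = mu * rho ^+ 4 * D2%:~R.
  by rewrite /d2 /den2 e23 e31 e12 ew1 ew2 ew3 /D2 /dot3; ring.
have ed3 : d3 = mu ^+ 2 * rho ^+ 7 * (ga%:~R * D3%:~R).
  by rewrite /d3 /den3 e23 e31 e12 ew1 ew2 ew3 /D3 /W3 /dot3; ring.
have eV : formV w1 w2 w3 = (mu * rho ^+ 3) ^+ 3 * (formV W1 W2 W3)%:~R.
  by rewrite ew1 ew2 ew3 /formV; ring.
have eG : formG w1 w2 w3 = (mu * rho ^+ 3) ^+ 3 * (formG W1 W2 W3)%:~R.
  by rewrite ew1 ew2 ew3 /formG; ring.
have eH : formG w2 w1 w3 = (mu * rho ^+ 3) ^+ 3 * (formG W2 W1 W3)%:~R.
  by rewrite ew1 ew2 ew3 /formG; ring.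
have eD : formD w1 w2 w3 = (mu * rho ^+ 3) ^+ 2 * (formD W1 W2 W3)%:~R.
  by rewrite ew1 ew2 ew3 /formD; ring.
have intn m : mod3 m != 0 -> m%:~R != 0 :> rat.
  by rewrite intr_eq0; apply: mod3_neq0.
have gan' : ga%:~R != 0 :> rat by rewrite intr_eq0.
have [D1n' D2n' D3n'] := And3 (intn _ D1n) (intn _ D2n) (intn _ D3n).
have [aln' ben' Vn'] := And3 (intn _ aln) (intn _ ben) (intn _ Vn).
have d1n : d1 != 0 by rewrite ed1; nonzero.
have d2n : d2 != 0 by rewrite ed2; nonzero.
have d3n : d3 != 0 by rewrite ed3; nonzero.
have wVn : formV w1 w2 w3 != 0 by rewrite eV; nonzero.
have t12 : t1 != t2 by rewrite -subr_eq0 e12; nonzero.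
have t23 : t2 != t3 by rewrite -subr_eq0 e23; nonzero.
have t31 : t3 != t1 by rewrite -subr_eq0 e31; nonzero.
split; split=> //.
have [qn1 qn2 qn3] := quad_new d1n d2n d3n t12 t23 t31 wVn.
have ne := (D1n', D2n', D3n', gan', aln', ben', mn, rn).
(* Over the common denominator d1 d2 d3 the new differences are proportional to G d1, H d2 and - D
   d3, with d3 contributing the old ga. The new values of B are cleared by (D1 D2 D3)^3; in the
   third one the ga^3 of w3 cancels that of d3^3 and leaves b3. *)
exists (- (al%:~R * be%:~R * ga%:~R * mu ^+ 4 * rho ^+ 16) / (d1 * d2 * d3)).
exists (d1 * d2 * d3 / (al%:~R * be%:~R * ga%:~R * mu ^+ 3 * rho ^+ 15 *
   (D1%:~R * D2%:~R * D3%:~R) ^+ 3)).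
exists (formG W1 W2 W3 * D1), (formG W2 W1 W3 * D2).
exists (- (formD W1 W2 W3 * (ga * D3))).
exists (- (D2 * D3) ^+ 3), (- (D1 * D3) ^+ 3), (W1 * W2 * b3 * (D1 * D2) ^+ 3).
split; [split | split; [split | split; split]].
- nonzero.
- rewrite new_sub23 -/d2 -/d3 // eG e23 e31 e12 ed1 ed2 ed3.
  move: (formG _ _ _) => U; field; by rewrite !ne.
- rewrite new_sub31 -/d1 -/d3 // eH e23 e31 e12 ed1 ed2 ed3.
  move: (formG _ _ _) => U; field; by rewrite !ne.
- rewrite new_sub12 -/d1 -/d2 // eD e23 e31 e12 ed1 ed2 ed3.
  move: (formD _ _ _) => U; field; by rewrite !ne.
- nonzero.
- rewrite qn1 -/d1 -/d2 -/d3 e23 e31 e12 ed1 ed2 ed3; field; by rewrite !ne.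
- rewrite qn2 -/d1 -/d2 -/d3 e23 e31 e12 ed1 ed2 ed3; field; by rewrite !ne.
- rewrite qn3 -/w1 -/w2 -/w3 -/d1 -/d2 -/d3 ed1 ed2 ed3 ew1 ew2 ew3.
  rewrite e23 e31 e12 /W3.
  field; by rewrite !ne.
- by rewrite /mod3 rmorphM mulf_neq0.
- by rewrite oppr_eq0.
- by rewrite dvdzE abszN -dvdzE.
- by rewrite /mod3 rmorphN rmorphXn rmorphM ; nonzero.
- have e u : mod3 (- (u * D3) ^+ 3) = - (mod3 u * mod3 D3) ^+ 3.
    by rewrite /mod3; ring.
  by rewrite !e eD12.
- have [? ?] := conj (mod3_neq0 W1n) (mod3_neq0 W2n).
  have [? ?] := conj (mod3_neq0 D1n) (mod3_neq0 D2n).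
  nonzero.
Qed.
End Step.

(** Comparing two representations ga / al = g' / a' of the same ratio, with a' prime to 3, shows
    that 3^(m+1) divides the fixed nonzero integer ga. *)
Lemma adapted_bounded q0 q1 q2 n t1 t2 t3 : adapted q0 q1 q2 n t1 t2 t3 ->
  exists N, forall m, adapted q0 q1 q2 m t1 t2 t3 -> (m < N)%N.
Proof.
move=> [rho [? [al [? [ga [? [? [? [[rn e23 _ e12]]]]]]]]]].
move=> [_ [[aln gan _] _]].
exists `|ga|%N => m.
move=> [r [? [a' [? [g' [? [? [? [[rn' e23' _ e12']]]]]]]]]].
move=> [_ [[an' gn' dg'] _]].
have eq_prod : g' * al = a' * ga.
  apply: (@intr_inj rat); apply: (mulfI (mulf_neq0 rn rn')).
  rewrite !rmorphM /=.
  transitivity (r * g'%:~R * (rho * al%:~R)); first by ring.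
  by rewrite -e12' -e23 e23' e12; ring.
have cop : coprimez (3 ^+ m.+1) a'.
  rewrite coprimezXl // coprimezE prime_coprime //.
  by rewrite -(dvdzE 3) dvd3_mod3.
have : (3 ^+ m.+1 %| ga)%Z.
  by rewrite -(Gauss_dvdzr _ cop) -eq_prod dvdz_mulr.
rewrite dvdzE abszX => /dvdn_leq; rewrite absz_gt0 => /(_ gan).
by apply: leq_trans; apply: ltn_trans (ltnSn m) (ltn_expl _ _).
Qed.

(** The triple r, 4r, 2r has differences 2r, r, -3r, and 4 = 1 modulo 3 makes B agree at r and 4r
    once its values are rescaled to integers. *)
Lemma adapted_base (q0 q1 q2 : rat) :
  [/\ q0 != 0, q1 = 0 & q2 = 0] \/ q0 = 0 /\ (q1 != 0) || (q2 != 0) ->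
  exists r, adapted q0 q1 q2 0 r (4%:R * r) (2%:R * r).
Proof.
move=> h.
suff [r [mu [b1 [b2 [b3 [H [rn mn c1 c2 c3]]]]]]] :
    exists r mu (b1 b2 b3 : int),
    [/\ quad q0 q1 q2 r = mu * b1%:~R,
      quad q0 q1 q2 (4%:R * r) = mu * b2%:~R &
      quad q0 q1 q2 (2%:R * r) = mu * b3%:~R] /\
    [/\ r != 0, mu != 0, mod3 b1 != 0, mod3 b2 = mod3 b1 & b3 != 0].
  exists r, r, mu, 2, 1, (-3), b1, b2, b3; split; [|split; [|split]].
  - by split; [exact: rn | ring | ring | ring].
  - by case: H.
  - by [].
  - by [].
case: h => [[n0 -> ->] | [-> ]].
  exists 1, q0, 1, 1, 1; split; last by [].
  by split; rewrite /quad; ring.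
have [-> /= n2 | n1] := eqVneq q1 0.
  exists 1, q2, 1, 16, 4; split; first by split; rewrite /quad; ring.
  by split=> //; apply/val_inj.
have [-> _ | n2 _] := eqVneq q2 0.
  exists 1, q1, 1, 4, 2; split; first by split; rewrite /quad; ring.
  by split=> //; apply/val_inj.
(* For this r the two terms of B at r are equal, so all values are integer multiples of q1^2 /
   q2. *)
exists (q1 / q2), (q1 ^+ 2 / q2), 2, 20, 6; split.
  by split; rewrite /quad; field.
split=> //; last by apply/val_inj.
  by rewrite mulf_neq0 ?invr_eq0.
by rewrite mulf_neq0 ?invr_eq0 ?expf_neq0.
Qed.

(** * Specialisation of the indeterminates *)

Section Specialisation.
Variables (n : nat) (tau : 'I_n -> rat).

(** A relation, because only the elements of the local ring at [tau] have a value there. *)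
Definition specialises (x : ratfun n) (c : rat) : Prop :=
  exists p q : {mpoly rat[n]},
    [/\ q.@[tau] != 0, x * tofrac q = tofrac p & p.@[tau] = c * q.@[tau]].

(** The transfer principle: the side conditions of the step on generic triples are checked at the
    rational point only. *)
Lemma spec_neq0 x c : specialises x c -> c != 0 -> x != 0.
Proof.
move=> [p [q [qn e ep]]] cn; apply/eqP => x0.
move: e; rewrite x0 mul0r => /esym/eqP; rewrite tofrac_eq0 => /eqP p0.
move: ep; rewrite p0 meval0 => /esym/eqP.
by rewrite mulf_eq0 (negPf cn) (negPf qn).
Qed.

Lemma spec_poly (p : {mpoly rat[n]}) : specialises (tofrac p) p.@[tau].
Proof. by exists p, 1; rewrite meval1 tofrac1 !mulr1 oner_neq0. Qed.

Lemma specD x y c d :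
  specialises x c -> specialises y d -> specialises (x + y) (c + d).
Proof.
move=> [p [q [qn e ep]]] [p' [q' [qn' e' ep']]].
exists (p * q' + p' * q), (q * q').
rewrite mevalD !mevalM mulf_neq0 // ep ep' tofracD !tofracM -e -e'.
by split=> //; ring.
Qed.

Lemma specM x y c d :
  specialises x c -> specialises y d -> specialises (x * y) (c * d).
Proof.
move=> [p [q [qn e ep]]] [p' [q' [qn' e' ep']]].
exists (p * p'), (q * q').
by rewrite !mevalM mulf_neq0 // ep ep' !tofracM -e -e'; split=> //; ring.
Qed.

Lemma specN x c : specialises x c -> specialises (- x) (- c).
Proof.
move=> [p [q [qn e ep]]]; exists (- p), q.
by rewrite mevalN tofracN -e ep !mulNr.
Qed.

Lemma specB x y c d :
  specialises x c -> specialises y d -> specialises (x - y) (c - d).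
Proof. by move=> sx sy; apply: specD sx (specN sy). Qed.

Lemma spec1 : specialises 1 1.
Proof.
by exists 1, 1; rewrite meval1 tofrac1 !mulr1 oner_neq0.
Qed.

Lemma spec0 : specialises 0 0.
Proof.
by exists 0, 1; rewrite meval0 meval1 tofrac0 !mul0r oner_neq0.
Qed.

Lemma specX x c k : specialises x c -> specialises (x ^+ k) (c ^+ k).
Proof.
move=> sx; elim: k => [|k IH]; first exact: spec1.
by rewrite !exprS; apply: specM.
Qed.

Lemma specV x c : c != 0 -> specialises x c -> specialises x^-1 c^-1.
Proof.
move=> cn sx; have xn := spec_neq0 sx cn.
case: sx => [p [q [qn e ep]]]; exists q, p.
rewrite ep mulf_neq0 // mulKf //; split=> //.
by rewrite -e mulKf.
Qed.

Lemma spec_unique x c d : specialises x c -> specialises x d -> c = d.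
Proof.
move=> sc sd; apply/eqP; rewrite -subr_eq0; apply: contraT => cd.
by have := spec_neq0 (specB sc sd) cd; rewrite subrr eqxx.
Qed.

Lemma spec_indet k : specialises (indet n k) (tau k).
Proof. by rewrite ffunE -(mevalXU tau k); apply: spec_poly. Qed.
End Specialisation.

Section SpecTriple.
Variables (n : nat) (tau : 'I_n -> rat).
Local Notation "x ~> c" := (specialises tau x c) (at level 70).
Variables (q0 q1 q2 t1 t2 t3 : ratfun n) (p0 p1 p2 y1 y2 y3 : rat).
Hypotheses (sq0 : q0 ~> p0) (sq1 : q1 ~> p1) (sq2 : q2 ~> p2).
Hypotheses (st1 : t1 ~> y1) (st2 : t2 ~> y2) (st3 : t3 ~> y3).

Lemma spec_quad x c : x ~> c -> quad q0 q1 q2 x ~> quad p0 p1 p2 c.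
Proof. by move=> sx; do ![apply: specD | apply: specM | apply: specX]. Qed.

Lemma spec_dot3 u1 u2 u3 v1 v2 v3 c1 c2 c3 d1 d2 d3 :
  u1 ~> c1 -> u2 ~> c2 -> u3 ~> c3 -> v1 ~> d1 -> v2 ~> d2 -> v3 ~> d3 ->
  dot3 u1 u2 u3 v1 v2 v3 ~> dot3 c1 c2 c3 d1 d2 d3.
Proof. by move=> *; do ![apply: specD | apply: specM]. Qed.

Variables (w1 w2 w3 : ratfun n) (v1 v2 v3 : rat).
Hypotheses (sw1 : w1 ~> v1) (sw2 : w2 ~> v2) (sw3 : w3 ~> v3).

Lemma spec_den1 : den1 t1 t2 t3 w1 w2 w3 ~> den1 y1 y2 y3 v1 v2 v3.
Proof. by apply: spec_dot3 => //; apply: specB. Qed.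

Lemma spec_den2 : den2 t1 t2 t3 w1 w2 w3 ~> den2 y1 y2 y3 v1 v2 v3.
Proof. by apply: spec_dot3 => //; apply: specB. Qed.

Lemma spec_den3 : den3 t1 t2 t3 w1 w2 w3 ~> den3 y1 y2 y3 v1 v2 v3.
Proof. by apply: spec_dot3; by [apply: specB | apply: specM]. Qed.

Lemma spec_new1 : den1 y1 y2 y3 v1 v2 v3 != 0 ->
  new1 t1 t2 t3 w1 w2 w3 ~> new1 y1 y2 y3 v1 v2 v3.
Proof.
move=> dn; apply: specM; last exact: specV dn spec_den1.
by apply: spec_dot3 => //; apply: specM => //; apply: specB.
Qed.

Lemma spec_new2 : den2 y1 y2 y3 v1 v2 v3 != 0 ->
  new2 t1 t2 t3 w1 w2 w3 ~> new2 y1 y2 y3 v1 v2 v3.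
Proof.
move=> dn; apply: specM; last exact: specV dn spec_den2.
by apply: spec_dot3 => //; apply: specM => //; apply: specB.
Qed.

Lemma spec_new3 : den3 y1 y2 y3 v1 v2 v3 != 0 ->
  new3 t1 t2 t3 w1 w2 w3 ~> new3 y1 y2 y3 v1 v2 v3.
Proof.
move=> dn; apply: specM; last exact: specV dn spec_den3.
by apply: spec_dot3; apply: specM => //; apply: specB.
Qed.

End SpecTriple.

(** * The orbit of the generic triple *)

Lemma cubic_pencil_trans (F : fieldType)
    (q0 q1 q2 t1 t2 t3 x1 x2 x3 z1 z2 z3 l m : F) :
  cubic x1 x2 x3 = cubic t1 t2 t3 + l%:P * quadp q0 q1 q2 ->
  cubic z1 z2 z3 = cubic x1 x2 x3 + m%:P * quadp q0 q1 q2 ->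
  cubic z1 z2 z3 = cubic t1 t2 t3 + (l + m)%:P * quadp q0 q1 q2.
Proof. by move=> -> ->; rewrite polyCD mulrDl addrA. Qed.

(** The step runs in parallel on the generic triple and on its specialisation: [adapted_new]
    provides the nonvanishing at the rational triple, [spec_neq0] lifts it, and the scalars in front
    of B add up. *)
Lemma orbit n (tau : 'I_n -> rat) (q0 q1 q2 t1 t2 t3 : ratfun n)
    (p0 p1 p2 y1 y2 y3 : rat) :
    specialises tau q0 p0 -> specialises tau q1 p1 -> specialises tau q2 p2 ->
    specialises tau t1 y1 -> specialises tau t2 y2 -> specialises tau t3 y3 ->
    adapted p0 p1 p2 0 y1 y2 y3 ->
  forall N, exists (x1 x2 x3 lam : ratfun n) (z1 z2 z3 : rat),
    [/\ specialises tau x1 z1, specialises tau x2 z2, specialises tau x3 z3,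
        adapted p0 p1 p2 N z1 z2 z3 &
        cubic x1 x2 x3 = cubic t1 t2 t3 + lam%:P * quadp q0 q1 q2].
Proof.
move=> sq0 sq1 sq2 st1 st2 st3 ad; elim=> [|N IH].
  by exists t1, t2, t3, 0, y1, y2, y3; rewrite polyC0 mul0r addr0.
have [x1 [x2 [x3 [lam [z1 [z2 [z3 [sx1 sx2 sx3 adz cub]]]]]]]] := IH.
have := adapted_new adz.
set v1 := quad _ _ _ z1 * _; set v2 := quad _ _ _ z2 * _.
set v3 := quad _ _ _ z3 * _ => -[[d1n d2n d3n Vn] [z12 z23 z31 adz']].
have sB := specB; have sQ := @spec_quad _ tau q0 q1 q2 p0 p1 p2 sq0 sq1 sq2.
pose w1 := quad q0 q1 q2 x1 * (x2 - x3) ^+ 3.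
pose w2 := quad q0 q1 q2 x2 * (x3 - x1) ^+ 3.
pose w3 := quad q0 q1 q2 x3 * (x1 - x2) ^+ 3.
have sw1 : specialises tau w1 v1 by apply: specM; [apply: sQ | apply/specX/sB].
have sw2 : specialises tau w2 v2 by apply: specM; [apply: sQ | apply/specX/sB].
have sw3 : specialises tau w3 v3 by apply: specM; [apply: sQ | apply/specX/sB].
have sneq u1 u2 c1 c2 : specialises tau u1 c1 -> specialises tau u2 c2 ->
    c1 != c2 -> u1 != u2.
  move=> s1 s2; rewrite -subr_eq0 -(subr_eq0 u1) => cn.
  exact: spec_neq0 (specB s1 s2) cn.
have := @cubic_new _ q0 q1 q2 x1 x2 x3.
rewrite -/w1 -/w2 -/w3.
move=> /(_ (spec_neq0 (spec_den1 sx1 sx2 sx3 sw1 sw2 sw3) d1n)).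
move=> /(_ (spec_neq0 (spec_den2 sx1 sx2 sx3 sw1 sw2 sw3) d2n)).
move=> /(_ (spec_neq0 (spec_den3 sx1 sx2 sx3 sw1 sw2 sw3) d3n)).
move=> /(_ (sneq _ _ _ _ sx1 sx2 z12) (sneq _ _ _ _ sx2 sx3 z23)).
move=> /(_ (sneq _ _ _ _ sx3 sx1 z31)).
set l := (X in X%:P) => cub'.
exists (new1 x1 x2 x3 w1 w2 w3), (new2 x1 x2 x3 w1 w2 w3).
exists (new3 x1 x2 x3 w1 w2 w3), (lam + l), (new1 z1 z2 z3 v1 v2 v3).
exists (new2 z1 z2 z3 v1 v2 v3), (new3 z1 z2 z3 v1 v2 v3).
split; last first.
- exact: cubic_pencil_trans cub cub'.
- exact: adz'.
- exact: spec_new3.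
- exact: spec_new2.
- exact: spec_new1.
Qed.

(** * The symmetric functions *)

Lemma esigma_coef n (K : fieldType) k (x : {ffun 'I_n -> K}) : (k <= n)%N ->
  esigma k x = (-1) ^+ k * (\prod_i ('X - (x i)%:P))`_(n - k).
Proof.
move=> kn.
have := mroots_coeff [tuple x i | i < n] (Ordinal (kn : (k < n.+1)%N)).
rewrite big_tuple => /= e.
rewrite (eq_bigr (fun i => 'X - (tnth [tuple x i | i < n] i)%:P)); last first.
  by move=> i _; rewrite tnth_mktuple.
rewrite e mulrA -expr2 sqrr_sign mul1r.
by apply: meval_eq => i; rewrite tnth_mktuple.
Qed.

(** * The choice of B *)

Section Window.
Variables (F : fieldType) (P : {poly F}) (d e : nat).
Let r k (u : nat) := (P * 'X^u)`_k.
(* The cross product of the coefficient vectors of B -> (B P)`_d and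
   B -> (B P)`_e. *)
Definition window0 := r d 1 * r e 2 - r d 2 * r e 1.
Definition window1 := r d 2 * r e 0 - r d 0 * r e 2.
Definition window2 := r d 0 * r e 1 - r d 1 * r e 0.

(** A cross product is orthogonal to both of its factors. *)
Lemma window_orthogonal k : k \in [:: d; e] ->
  (quadp window0 window1 window2 * P)`_k = 0.
Proof.
have -> : quadp window0 window1 window2 * P = window0%:P * (P * 'X^0) +
    window1%:P * (P * 'X^1) + window2%:P * (P * 'X^2).
  by rewrite /quadp; ring.
rewrite !coefD !coefCM -!/(r k _).
by rewrite !inE /window0 /window1 /window2 => /orP[] /eqP->; rewrite /r; ring.
Qed.
End Window.

Lemma spec_window n (tau : 'I_n -> rat) (P : {poly ratfun n})
    (Q : {poly rat}) d e :
    (forall k, specialises tau P`_k Q`_k) ->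
  [/\ specialises tau (window0 P d e) (window0 Q d e),
      specialises tau (window1 P d e) (window1 Q d e) &
      specialises tau (window2 P d e) (window2 Q d e)].
Proof.
move=> sPQ; have sr k u : specialises tau (P * 'X^u)`_k (Q * 'X^u)`_k.
  by rewrite !coefMXn; case: ifP => // _; apply: spec0.
by split; apply: specB; apply: specM.
Qed.

Lemma spec_prodXsub n (tau : 'I_n -> rat) (I : finType) (f : I -> ratfun n)
    (g : I -> rat) : (forall i, specialises tau (f i) (g i)) ->
  forall k, specialises tau (\prod_i ('X - (f i)%:P))`_k
                            (\prod_i ('X - (g i)%:P))`_k.
Proof.
move=> sfg; pose K (P : {poly ratfun n}) (Q : {poly rat}) :=
  forall k, specialises tau P`_k Q`_k.
rewrite -/(K _ _); apply: (big_ind2 K).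
- by move=> k; rewrite !coef1; case: (k == 0%N); [apply: spec1 | apply: spec0].
- move=> P Q P' Q' sP sP' k; rewrite !coefM.
  apply: (big_ind2 (specialises tau)); first exact: spec0.
    by move=> *; apply: specD.
  by move=> i _; apply: specM.
move=> i _ k; rewrite !coefB !coefX !coefC; apply: specB.
  by case: (k == 1%N); [apply: spec1 | apply: spec0].
by case: (k == 0%N) => //; apply: spec0.
Qed.

Lemma coef_XD1_exp (R : nzRingType) p k :
  (('X + 1 : {poly R}) ^+ p)`_k = 'C(p, k)%:R.
Proof.
rewrite exprD1n coef_sum.
under eq_bigr do rewrite coefMn coefXn.
have [kp | pk] := leqP k p.
  rewrite (bigD1 (Ordinal (kp : (k < p.+1)%N))) //= eqxx big1 ?addr0 // => l nl.
  by rewrite (_ : (k == l) = false) ?mul0rn // eq_sym; apply: negbTE.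
rewrite bin_small // big1 // => l _.
by rewrite gtn_eqF ?mul0rn //; apply: leq_ltn_trans pk; rewrite -ltnS.
Qed.

(** Put n = m + 3. For j >= 3 the lowest degree in P is n - j, so one condition reads B(0) = 0. The
    other is a relation between q1 and q2 with coefficients 'C(j - 3, j - i - 1) and 'C(j - 3, j - i
    - 2), read as 0 when j - i - 2 is negative: the first is nonzero if i > 1, the second is 1 if i
    = 1. *)
Lemma window_nondegenerate (m i j : nat) (P : {poly rat}) :
    (0 < i)%N -> (i < j)%N -> (j <= m.+3)%N ->
    P = ('X + 1) ^+ (j - 3) * 'X^(m - (j - 3)) ->
  let q0 := window0 P (m.+3 - i) (m.+3 - j) in
  let q1 := window1 P (m.+3 - i) (m.+3 - j) in
  let q2 := window2 P (m.+3 - i) (m.+3 - j) in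
  [/\ q0 != 0, q1 = 0 & q2 = 0] \/ q0 = 0 /\ (q1 != 0) || (q2 != 0).
Proof.
move=> i0 ij jm ->; rewrite /window0 /window1 /window2.
set z := (m - (j - 3))%N; set p := (j - 3)%N.
set d := (m.+3 - i)%N; set e := (m.+3 - j)%N.
have r k u : (('X + 1 : {poly rat}) ^+ p * 'X^z * 'X^u)`_k =
    if (k < z + u)%N then 0 else 'C(p, k - (z + u))%:R.
  by rewrite -mulrA -exprD coefMXn coef_XD1_exp.
rewrite !r; have [j3 | j3] := leqP 3 j; last first.
  (* Truncated subtraction makes P = X^m here, and the two conditions kill the coefficients of X and
     X^2 in B. *)
  have [ei ej] : i = 1%N /\ j = 2%N by lia.
  have -> : p = 0%N by lia.
  have [-> ->] : d = (z + 2)%N /\ e = (z + 1)%N by lia.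
  by left; rewrite !ltn_add2l !subnDl !subn0 /= !bin0n.
right; have zm : e = (z + 0)%N by lia.
have zd : d = (z + (j - i))%N by lia.
rewrite zm zd !ltn_add2l !subnDl /= bin0 !(mul0r, mulr0, subr0, sub0r, mulr1).
split=> //; rewrite oppr_eq0.
have [jip | jip] := leqP (j - i - 1) p.
  have -> : (j - i < 1)%N = false by lia.
  by rewrite pnatr_eq0 -lt0n bin_gt0 jip orbT.
have -> : (j - i = p + 2)%N by lia.
have -> : (p + 2 < 2)%N = false by lia.
by rewrite addnK binn oner_neq0.
Qed.

Lemma prod_step_roots (R : comNzRingType) m p : (p <= m)%N ->
  \prod_(k < m) ('X - (if (k < p)%N then -1 else 0)%:P) =
  ('X + 1) ^+ p * 'X^(m - p) :> {poly R}.
Proof.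
move=> pm; move: (m - p)%N (subnKC pm) => k <-; rewrite big_split_ord /=.
congr (_ * _).
  rewrite (eq_bigr (fun=> 'X + 1)) ?prodr_const ?card_ord // => l _.
  by rewrite ltn_ord polyCN opprK.
rewrite (eq_bigr (fun=> 'X)) ?prodr_const ?card_ord // => l _.
by rewrite ltnNge leq_addr /= subr0.
Qed.

(** * Completing a triple to a solution *)

Definition shift3 m (k : 'I_m) : 'I_m.+3 := lift ord0 (lift ord0 (lift ord0 k)).

Lemma prod_first3 (F : fieldType) m (x : 'I_m.+3 -> F) :
  \prod_i ('X - (x i)%:P) =
  cubic (x ord0) (x (lift ord0 ord0)) (x (lift ord0 (lift ord0 ord0))) *
  \prod_k ('X - (x (shift3 k))%:P).
Proof. by rewrite !big_ord_recl /cubic !mulrA. Qed.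

(** The default value of [nth] is [t k] itself, so the entries from index 3 on are those of [t]. *)
Definition with_first3 m (F : fieldType) (x1 x2 x3 : F)
    (t : {ffun 'I_m.+3 -> F}) :
    {ffun 'I_m.+3 -> F} :=
  [ffun k : 'I_m.+3 => nth (t k) [:: x1; x2; x3] k].

(** The change of the three roots adds l B P to the full product, and the coefficient that Vieta
    reads off for [k] is zero in B P. *)
Lemma esigma_with_first3 m (F : fieldType) (q0 q1 q2 l x1 x2 x3 : F) k
    (t : {ffun 'I_m.+3 -> F}) :
    (k <= m.+3)%N ->
    cubic x1 x2 x3 = cubic (t ord0) (t (lift ord0 ord0))
      (t (lift ord0 (lift ord0 ord0))) + l%:P * quadp q0 q1 q2 ->
    (quadp q0 q1 q2 * \prod_k ('X - (t (shift3 k))%:P))`_(m.+3 - k) = 0 ->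
  esigma k (with_first3 x1 x2 x3 t) = esigma k t.
Proof.
move=> km cub z; rewrite !esigma_coef // !prod_first3.
rewrite !ffunE /= (eq_bigr (fun k => 'X - (t (shift3 k))%:P)); last first.
  by move=> i _; rewrite ffunE /= nth_nil.
by rewrite cub mulrDl coefD -mulrA coefCM z mulr0 addr0.
Qed.

Lemma bounded_on_seq (T : eqType) (Q : T -> nat -> Prop) (s : seq T) :
    (forall x, exists N, forall n, Q x n -> (n < N)%N) ->
  exists N, forall x, x \in s -> forall n, Q x n -> (n < N)%N.
Proof.
move=> bQ; elim: s => [|x s [N IH]]; first by exists 0%N.
have [M bM] := bQ x; exists (maxn M N) => y.
rewrite inE => /orP[/eqP-> | ys] n Qn.
  by rewrite leq_max bM.
by rewrite leq_max (IH y ys n Qn) orbT.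
Qed.

(* Infinitely many solutions *)
Local Close Scope ring_scope.

Theorem theorem3 (n i j : nat) (hn : 3 <= n) (hi : 1 <= i) (hij : i < j)
    (hj : j <= n) :
  infinite_set [set x : {ffun 'I_n -> ratfun n} |
    esigma i x = esigma i (indet n) /\ esigma j x = esigma j (indet n)].
Proof.
case: n hn hj => [|[|[|m]]] // _ jm.
(* This makes P specialise to (X + 1)^(j - 3) X^(n - j) if 3 <= j, so that B
   becomes divisible by X, and to X^(n - 3) if j = 2, when B is constant. *)
pose g k : rat := if (k < j - 3)%N then (-1)%R else 0%R.
pose P := (\prod_(k < m) ('X - (indet m.+3 (shift3 k))%:P))%R.
pose Q := (\prod_(k < m) ('X - (g k)%:P))%R.
have eQ : Q = (('X + 1) ^+ (j - 3) * 'X^(m - (j - 3)))%R.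
  by apply: prod_step_roots; lia.
have [r ad] := adapted_base (window_nondegenerate hi hij jm eQ).
(* The first three indeterminates go to the base triple, the others to the roots of [Q]; the default
   of [nth] handles the latter. *)
pose tau (k : 'I_m.+3) : rat :=
  nth (g (k - 3)%N) [:: r; (4%:R * r)%R; (2%:R * r)%R] k.
have sPQ : forall k, specialises tau (P`_k)%R (Q`_k)%R.
  apply: spec_prodXsub => k.
  have -> : g k = tau (shift3 k) by rewrite /tau !lift0 /= nth_nil !subSS subn0.
  exact: spec_indet.
have [s0 s1 s2] := spec_window (m.+3 - i) (m.+3 - j) sPQ.
have orb := orbit s0 s1 s2 (spec_indet tau ord0)
  (spec_indet tau (lift ord0 ord0))
  (spec_indet tau (lift ord0 (lift ord0 ord0))) ad.
set p0 := window0 Q _ _ in ad orb; set p1 := window1 Q _ _ in ad orb.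
set p2 := window2 Q _ _ in ad orb.
(* Levels separate solutions: each tuple has bounded levels, while the orbit reaches every level. *)
pose level (x : {ffun 'I_m.+3 -> ratfun m.+3}) N := exists z1 z2 z3,
  [/\ specialises tau (x ord0) z1, specialises tau (x (lift ord0 ord0)) z2,
      specialises tau (x (lift ord0 (lift ord0 ord0))) z3 &
      adapted p0 p1 p2 N z1 z2 z3].
have level_bounded x : exists N, forall n, level x n -> (n < N)%N.
  (* If x has some level, its specialised triple is unique and [adapted_bounded] applies to it;
     otherwise any bound will do. *)
  have [[N [z1 [z2 [z3 [sz1 sz2 sz3 adz]]]]] | no] :=
    boolp.EM (exists N, level x N); last first.
    by exists 0%N => n ln; case: no; exists n.
  have [M bM] := adapted_bounded adz; exists M => n.
  move=> [y1 [y2 [y3 [sy1 sy2 sy3]]]].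
  rewrite (spec_unique sy1 sz1) (spec_unique sy2 sz2) (spec_unique sy3 sz3).
  exact: bM.
(* If a finite list [s] held all solutions, their levels would lie below a common N, but the orbit
   yields a solution of level N. *)
move=> /finite_seqP[s es].
have [N bN] := bounded_on_seq s level_bounded.
have [x1 [x2 [x3 [l [z1 [z2 [z3 [sx1 sx2 sx3 adz cub]]]]]]]] := orb N.
pose x := with_first3 x1 x2 x3 (indet m.+3).
suff xs : x \in s.
  have lx : level x N by exists z1, z2, z3; rewrite !ffunE.
  by have := bN x xs N lx; rewrite ltnn.
have : [set` s] x; last by [].
rewrite -es; split.
  apply: esigma_with_first3 cub _; first by lia.
  by apply: window_orthogonal; rewrite inE eqxx.
apply: esigma_with_first3 cub _; first by lia.
by apply: window_orthogonal; rewrite !inE eqxx orbT.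
Qed.
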